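(* Let $S$ be the set containing 4 copies of each positive integer congruent to $0$ or $\pm 1$ modulo 6, 2 copies of each even positive integer that is not a multiple of 3, and 8 copies of each odd positive multiple of 3; let $T$ be the set containing 4 copies of each positive integer congruent to $3$ or $\pm 2$ modulo 6, 2 copies of each positive integer congruent to $\pm 1$ modulo 6, and 8 copies of each positive multiple of 6. Let $D_S(N)$ (respectively, $D_T(N)$) be the number of partitions of $N$ into distinct elements of $S$ (respectively, $T$). Then, for every integer $N\geq 1$, $$D_S(N)=4\,D_T(N-1).$$
   Context: A ''set containing several copies'' of certain integers means a set of colored integers: the different copies of the same integer are regarded as distinct (distinguishable) elements, each having that integer as its value. A partition of $N$ into distinct elements of $X$ is a finite subset of $X$ whose elements have values summing to $N$ (so each copy is used at most once, but different copies of the same integer may be used together, and subsets using different copies are counted as different). The empty partition is the unique partition of $0$. No restriction is imposed on the number of parts. *)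

(* Defs.v *)
From mathcomp Require Import all_boot.
From mathcomp Require Import finmap.

Set Implicit Arguments.
Unset Strict Implicit.
Unset Printing Implicit Defensive.

Local Open Scope fset_scope.

(* The copy number c (counted from 0) of the integer v is the pair (v, c). *)
Definition colored : Type := (nat * nat)%type.

Definition value (x : colored) : nat := x.1.

Definition copies (m : nat -> nat) : pred colored :=
  fun x => (0 < x.1) && (x.2 < m x.1).

(* multS n, multT n: number of copies of n in S, in T; residues -1 and -2
   modulo 6 are 5 and 4. The value at n = 0 is never used (see copies). *)
Definition multS (n : nat) : nat :=
  if n %% 6 \in [:: 0; 1; 5] then 4
  else if ~~ odd n && ~~ (3 %| n) then 2
  else if odd n && (3 %| n) then 8
  else 0.

Definition multT (n : nat) : nat :=
  if n %% 6 \in [:: 3; 2; 4] then 4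
  else if n %% 6 \in [:: 1; 5] then 2
  else if 6 %| n then 8
  else 0.

Definition is_partition (X : pred colored) (N : nat) (A : {fset colored}) : bool :=
  all X A && (\sum_(x <- A) value x == N).

(* The elements of a partition of N have values at most N, so all partitions of N
   are subsets of the finite set elements_upto m N; see partitionsP. *)
Definition elements_upto (m : nat -> nat) (N : nat) : {fset colored} :=
  [fset x in [seq (v, c) | v <- iota 1 N, c <- iota 0 (m v)]].

Definition partitions (m : nat -> nat) (N : nat) : {fset {fset colored}} :=
  [fset A in fpowerset (elements_upto m N) | is_partition (copies m) N A].

Lemma elements_uptoP (m : nat -> nat) (N : nat) (x : colored) :
  (x \in elements_upto m N) = copies m x && (value x <= N).
Proof.
rewrite /elements_upto !inE /copies /value; case: x => v c /=.
apply/allpairsPdep/idP.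
  by case=> a [b [ha hb [-> ->]]]; move: ha hb; rewrite !mem_iota /= add1n ltnS add0n
     => /andP[-> ->] ->.
move=> /andP[/andP[h1 h2] h3]; exists v, c.
by rewrite !mem_iota /= add1n ltnS add0n h1 h2 h3.
Qed.

Lemma partitionsP (m : nat -> nat) (N : nat) (A : {fset colored}) :
  (A \in partitions m N) = is_partition (copies m) N A.
Proof.
rewrite /partitions !inE /= fpowersetE andb_idl // => /andP[/allP hA /eqP hN].
apply/fsubsetP => x xA; rewrite elements_uptoP hA //= -hN.
by rewrite (big_rem x) //= leq_addr.
Qed.

Definition D (m : nat -> nat) (N : nat) : nat := #|` partitions m N|.
Definition D_S (N : nat) : nat := D multS N.
Definition D_T (N : nat) : nat := D multT N.

(* Main.v *)
Require Import Defs.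
From mathcomp Require Import all_boot all_order all_algebra.
From mathcomp Require Import finmap.
From mathcomp Require Import zify ring.

(** With F_S and F_T the generating functions of D_S and D_T, the claim reads
F_S(q) = 1 + 4 q F_T(q).  Write

  a(q) = prod (1 + q^(2i+1))   and   b(q) = prod (1 + q^(2i+2)),  i >= 0.

Sorting the multiplicities by residue modulo 6 gives
F_S = a(q)^4 a(q^3)^4 b(q)^2 b(q^3)^2 and F_T = a(q)^2 a(q^3)^2 b(q)^4 b(q^3)^4
([gen_prodS], [gen_prodT]).  Euler's theorem on odd and distinct parts is
a(q) b(q) a(-q) = 1 ([euler_odd_distinct]), and it reduces the claim to

  a(q)^2 a(q^3)^2 - a(-q)^2 a(-q^3)^2 = 4 q b(q)^2 b(q^3)^2

([phi_psi_identity], [ST_product_identity]).  By the Jacobi triple product,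
each square becomes a theta series after multiplication by a product
prod (1 - q^(2ei)) with e = 1 or 3: the left-hand side turns into twice the sum of
q^(m^2 + 3 d^2) over the integers with m + d odd, and the right-hand side into
the sum of q^(j(j-1) + 3k(k-1) + 1) over all integers j, k.  The two agree
([theta_lattice_identity]): if j = k modulo 2, the substitution
m = (j + 3k - 2)/2, d = (j - k)/2 preserves the exponent and is a bijection onto
the pairs with m + d odd; the remaining pairs (j, k) are brought to this case
by k |-> 1 - k.  In terms of u = 2j - 1 and v = 2k - 1 this is multiplication of
(u + v sqrt(-3))/2 by a sixth root of unity, followed by conjugation.

Infinite products and series are avoided by working in a commutative ring where
q^M = 0: there all of them are finite, and the products prod (1 - q^(ei)) can
be cancelled.  The triple product is the limit of its finite form with Gaussian
binomials ([finite_jacobi_triple]).  The identity is finally read off in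
Z[X]/(X^M), where the coefficients below X^M survive. *)

Set Implicit Arguments.
Unset Strict Implicit.
Unset Printing Implicit Defensive.

Import GRing.Theory.

Local Open Scope ring_scope.

(** * Finite q-products and Gaussian binomials *)

(** The q-Pochhammer symbol (-y; x)_n.  In particular [qprod (- x) x n] is
(x; x)_n, the product of the 1 - x^i for 1 <= i <= n. *)
Definition qprod (R : comNzRingType) (y x : R) (n : nat) : R :=
  \prod_(i < n) (1 + y * x ^+ i).

Lemma qprodS (R : comNzRingType) (y x : R) n :
  qprod y x n.+1 = qprod y x n * (1 + y * x ^+ n).
Proof. by rewrite /qprod big_ord_recr. Qed.

Lemma qprodSl (R : comNzRingType) (y x : R) n :
  qprod y x n.+1 = (1 + y) * qprod (y * x) x n.
Proof.
rewrite /qprod big_ord_recl expr0 mulr1; congr (_ * _).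
by apply: eq_bigr => i _; rewrite exprS mulrA.
Qed.

Lemma qprod_double (R : comNzRingType) (y x : R) n :
  qprod y x n.*2 = qprod y (x ^+ 2) n * qprod (y * x) (x ^+ 2) n.
Proof.
elim: n => [|n IH]; first by rewrite /qprod !big_ord0 mulr1.
rewrite doubleS !qprodS IH -!exprM mul2n (exprS x n.*2); ring.
Qed.

Lemma qprod_sqr (R : comNzRingType) (y x : R) n :
  qprod y x n * qprod (- y) x n = qprod (- y ^+ 2) (x ^+ 2) n.
Proof.
rewrite /qprod -big_split; apply: eq_bigr => i _ /=.
rewrite -exprM mulnC exprM; ring.
Qed.

(** The Gaussian binomial coefficient, through its Pascal rule: this form makes
sense in any ring, without dividing by the q-factorials. *)
Fixpoint qbin (R : comNzRingType) (x : R) (n k : nat) : R :=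
  match n, k with
  | _, 0 => 1
  | 0, _.+1 => 0
  | n'.+1, k'.+1 => qbin x n' k' + x ^+ k'.+1 * qbin x n' k'.+1
  end.

Lemma qbin0 (R : comNzRingType) (x : R) n : qbin x n 0 = 1.
Proof. by case: n. Qed.

Lemma qbin_gt (R : comNzRingType) (x : R) n k : (n < k)%N -> qbin x n k = 0.
Proof.
elim: n k => [|n IH] [|k] //= nk.
by rewrite !IH ?(ltnW nk) // mulr0 addr0.
Qed.

Lemma qbin_nn (R : comNzRingType) (x : R) n : qbin x n n = 1.
Proof.
elim: n => //= n IH.
by rewrite IH -/(qbin x n n.+1) qbin_gt // mulr0 addr0.
Qed.

(** The second Pascal rule, by induction from the first.  Both are used below,
one for each of the two products in the triple product. *)
Lemma qbinSr (R : comNzRingType) (x : R) n k : (k <= n)%N ->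
  qbin x n.+1 k.+1 = qbin x n k.+1 + x ^+ (n - k) * qbin x n k.
Proof.
elim: n k => [|n IH] [|k] // kn.
- by rewrite /= mulr0 addr0 add0r mulr1.
- have := IH 0%N isT; rewrite /= !qbin0 !subn0 !expr1 !mulr1 => E.
  by rewrite {1}E exprS mulrDr addrA.
case: (ltngtP k n) => [kn'|kn'|->]; last 1 first.
- rewrite -[LHS]/(qbin x n.+1 n.+1 + x ^+ n.+2 * qbin x n.+1 n.+2).
  by rewrite (qbin_gt x (ltnSn n.+1)) subnn mulr0 addr0 add0r mul1r.
- transitivity (qbin x n k.+1 + x ^+ (n - k) * qbin x n k +
    x ^+ k.+2 * (qbin x n k.+2 + x ^+ (n - k.+1) * qbin x n k.+1)).
    by rewrite -!IH // ltnW.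
  rewrite -[qbin x n.+1 k.+2]/(qbin x n k.+1 + x ^+ k.+2 * qbin x n k.+2).
  rewrite -[qbin x n.+1 k.+1]/(qbin x n k + x ^+ k.+1 * qbin x n k.+1) subSS.
  have [d ->] : exists d, n = (k + d).+1.
    by exists (n - k.+1)%N; rewrite -addSn subnKC.
  have -> : ((k + d).+1 - k = d.+1)%N by lia.
  have -> : ((k + d).+1 - k.+1 = d)%N by lia.
  rewrite !exprS; ring.
by lia.
Qed.

(** The quotient formula for Gaussian binomials, freed of denominators. *)
Lemma qbin_qprod (R : comNzRingType) (x : R) a b :
  qprod (- x) x a * qprod (- x) x b * qbin x (a + b) a = qprod (- x) x (a + b).
Proof.
have [s] := ubnP (a + b); elim: s a b => // s IH [|a] [|b] lt_s.
- by rewrite /qprod !big_ord0 !mul1r.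
- by rewrite /qprod big_ord0 add0n qbin0 mul1r mulr1.
- by rewrite addn0 qbin_nn {2}/qprod big_ord0 !mulr1.
rewrite addSn /= (qprodS _ _ (a + _)).
have E1 := IH a b.+1 ltac:(lia).
have E2 := IH a.+1 b ltac:(lia); rewrite addSnnS in E2.
rewrite mulrDr.
have -> : qprod (- x) x a.+1 * qprod (- x) x b.+1 * qbin x (a + b.+1) a =
  (1 - x ^+ a.+1) * qprod (- x) x (a + b.+1).
  by rewrite -E1 !qprodS !exprS; ring.
have -> : qprod (- x) x a.+1 * qprod (- x) x b.+1 *
  (x ^+ a.+1 * qbin x (a + b.+1) a.+1) =
  x ^+ a.+1 * (1 - x ^+ b.+1) * qprod (- x) x (a + b.+1).
  by rewrite -E2 !qprodS !exprS; ring.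
rewrite mulNr -exprS -addSn exprD; ring.
Qed.

(** * The finite Jacobi triple product *)

(** The j-th term y^j x^(j(j-1)/2) of the theta series.  For j < 0 the power of y
is rewritten with y w = x, which removes all negative exponents. *)
Definition theta_term (R : comNzRingType) (y w x : R) (j : int) : R :=
  match j with
  | Posz a => y ^+ a * x ^+ 'C(a, 2)
  | Negz a => w ^+ a.+1 * x ^+ 'C(a.+1, 2)
  end.

(** Lowering the index from j = k - n divides the term by y x^(j-1); as
y^-1 = w / x, multiplying by x^k leaves the factor w x^n. *)
Lemma theta_term_shift (R : comNzRingType) (y w x : R) n k : y * w = x ->
  theta_term y w x (k%:Z - n.+1%:Z) * x ^+ k =
  w * x ^+ n * theta_term y w x (k%:Z - n%:Z).
Proof.
move=> yw; case: (leqP k n) => kn.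
  have [b ->] : exists b, n = (b + k)%N by exists (n - k)%N; rewrite subnK.
  have -> : k%:Z - (b + k).+1%:Z = Negz b by lia.
  have -> : k%:Z - (b + k)%:Z = - b%:Z by lia.
  have -> : theta_term y w x (- b%:Z) = w ^+ b * x ^+ 'C(b, 2).
    by case: b => [|b].
  rewrite /theta_term binS bin1 !exprD exprS; ring.
have [a ->] : exists a, k = (a + n).+1 by exists (k - n.+1)%N; lia.
have -> : (a + n).+1%:Z - n.+1%:Z = Posz a by lia.
have -> : (a + n).+1%:Z - n%:Z = Posz a.+1 by lia.
rewrite /theta_term binS bin1 !exprS !exprD -{2}yw; ring.
Qed.

Lemma q_binomial_theorem (R : comNzRingType) (y x : R) m :
  qprod y x m = \sum_(k < m.+1) y ^+ k * x ^+ 'C(k, 2) * qbin x m k.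
Proof.
elim: m => [|m IH].
  by rewrite /qprod big_ord0 big_ord_recl big_ord0 /= !mulr1 addr0.
rewrite qprodS IH [in RHS]big_ord_recl [X in _ = X + _]/= !mulr1.
transitivity (1 + \sum_(k < m.+1) (y ^+ k.+1 * x ^+ 'C(k.+1, 2) * qbin x m k.+1
   + y ^+ k * x ^+ 'C(k, 2) * qbin x m k * (y * x ^+ m))).
  rewrite big_split addrA mulrDr mulr1 -mulr_suml; congr (_ + _) => //.
  rewrite [in RHS]big_ord_recr /= qbin_gt // mulr0 addr0 big_ord_recl /=.
  by rewrite qbin0 !mulr1.
congr (_ + _); apply: eq_bigr => k _.
have km : (k <= m)%N by rewrite -ltnS.
rewrite lift0 (qbinSr x km) binS bin1.
have -> : x ^+ m = x ^+ (m - k) * x ^+ k by rewrite -exprD subnK.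
rewrite exprD exprS; ring.
Qed.

(** Induction on n from the q-binomial theorem.  Multiplying by the next factor
1 + w x^n recentres the sum at n + 1: by the shift rule the additional terms are
the ones that the first Pascal rule asks for. *)
Lemma finite_jacobi_triple (R : comNzRingType) (y w x : R) m n : y * w = x ->
  qprod y x m * qprod w x n =
  \sum_(k < (m + n).+1) theta_term y w x (k%:Z - n%:Z) * qbin x (m + n) k.
Proof.
move=> yw; elim: n => [|n IH].
  rewrite {2}/qprod big_ord0 mulr1 addn0 q_binomial_theorem.
  by apply: eq_bigr => k _; rewrite subr0.
rewrite qprodS mulrA IH mulrDr mulr1 addnS.
(* The second sum, centred at n + 1, comes from w x^n; its last term is 0. *)
transitivity (\sum_(k < (m + n).+1)
    theta_term y w x (k%:Z - n%:Z) * qbin x (m + n) k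
  + \sum_(k < (m + n).+2)
    theta_term y w x (k%:Z - n.+1%:Z) * (x ^+ k * qbin x (m + n) k)).
  congr (_ + _); rewrite [in RHS]big_ord_recr /= qbin_gt // !mulr0 addr0 mulr_suml.
  by apply: eq_bigr => k _; rewrite [RHS]mulrA theta_term_shift //; ring.
rewrite [in RHS]big_ord_recl [X in _ + X = _]big_ord_recl !qbin0 !mulr1 addrCA.
congr (_ + _); rewrite -big_split; apply: eq_bigr => k _.
rewrite !lift0; have -> : k.+1%:Z - n.+1%:Z = k%:Z - n%:Z by lia.
exact/esym/mulrDr.
Qed.

(** * The triple product for a nilpotent base *)

Lemma expr_nil (R : comNzRingType) (x : R) M e :
  x ^+ M = 0 -> (M <= e)%N -> x ^+ e = 0.
Proof. by move=> xM /subnK <-; rewrite exprD xM mulr0. Qed.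

Lemma expr_expr_nil (R : comNzRingType) (x : R) M e :
  x ^+ M = 0 -> (0 < e)%N -> (x ^+ e) ^+ M = 0.
Proof. by move=> xM e0; rewrite -exprM (expr_nil xM) // leq_pmull. Qed.

Lemma prod_stable (R : comNzRingType) (f : nat -> R) M n :
  (forall i, (M <= i)%N -> f i = 1) -> (M <= n)%N ->
  \prod_(i < n) f i = \prod_(i < M) f i.
Proof.
move=> f1 /subnKC <-; rewrite big_split_ord /= [X in _ * X]big1 ?mulr1 // => i _.
by rewrite f1 ?leq_addr.
Qed.

Lemma qprod_stable (R : comNzRingType) (y x : R) M n :
  x ^+ M = 0 -> (M <= n)%N -> qprod y x n = qprod y x M.
Proof.
move=> xM; apply: (@prod_stable _ (fun i => 1 + y * x ^+ i)) => i Mi.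
by rewrite (expr_nil xM Mi) mulr0 addr0.
Qed.

(** Each factor 1 - x^i is invertible by the geometric series, which is finite as
x is nilpotent. *)
Lemma qprod_lreg (R : comNzRingType) (x : R) M n :
  x ^+ M = 0 -> GRing.lreg (qprod (- x) x n).
Proof.
move=> xM; elim: n => [|n IH]; first by rewrite /qprod big_ord0; apply: lreg1.
rewrite qprodS mulNr -exprS; apply: lregM => //.
have := subrX1 (x ^+ n.+1) M; rewrite expr_expr_nil // sub0r => /(congr1 -%R).
rewrite opprK -mulNr opprB => E a b.
move=> /(congr1 (fun z => z * \sum_(i < M) x ^+ n.+1 ^+ i)).
by rewrite ![_ * _ * \sum_(_ < _) _]mulrAC -E !mul1r.
Qed.

(** The limit of the Gaussian binomial [a + b, a] is 1 / (x; x)_oo, reached as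
soon as a and b reach the nilpotency index. *)
Lemma qbin_stable (R : comNzRingType) (x : R) M a b :
  x ^+ M = 0 -> (M <= a)%N -> (M <= b)%N ->
  qprod (- x) x M * qbin x (a + b) a = 1.
Proof.
move=> xM Ma Mb; apply: (qprod_lreg (n := M) xM).
have := qbin_qprod x a b.
rewrite (qprod_stable _ xM Ma) (qprod_stable _ xM Mb) (qprod_stable _ xM).
  by rewrite mulr1 mulrA.
by rewrite (leq_trans Ma) ?leq_addr.
Qed.

Lemma leq_bin2 M a : (M + 2 <= a)%N -> (M <= 'C(a, 2))%N.
Proof.
move=> Ma; apply: leq_trans (leq_bin2l 2 Ma).
by rewrite addn2 binS bin1; lia.
Qed.

Lemma theta_term0 (R : comNzRingType) (y w x : R) M j :
  x ^+ M = 0 -> (M + 2 <= `|j|)%N -> theta_term y w x j = 0.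
Proof.
move=> xM; case: j => a Ma; rewrite /theta_term (expr_nil xM) ?mulr0 //;
exact: leq_bin2.
Qed.

Definition irange (n : nat) : seq int :=
  [seq k%:Z - n%:Z | k <- iota 0 (n + n).+1].

Lemma mem_irange n j : (j \in irange n) = (`|j| <= n)%N.
Proof.
apply/mapP/idP => [[k]|jn]; first by rewrite mem_iota => kn ->; lia.
by exists (`|(j + n%:Z)%R|)%N; rewrite ?mem_iota; lia.
Qed.

Lemma irange_uniq n : uniq (irange n).
Proof. by rewrite map_inj_uniq ?iota_uniq // => a b; lia. Qed.

(** In the finite triple product, an index k at distance at least M + 2 from n has
a vanishing theta term, while k and 2n - k are at least M for all the others: there
the Gaussian binomial is already at its limit. *)
Lemma jacobi_triple (R : comNzRingType) (y w x : R) M n :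
  x ^+ M = 0 -> y * w = x -> (M.*2 + 2 <= n)%N ->
  qprod (- x) x M * (qprod y x M * qprod w x M) =
  \sum_(j <- irange n) theta_term y w x j.
Proof.
move=> xM yw Mn; have Mn' : (M <= n)%N by lia.
rewrite -(qprod_stable y xM Mn') -(qprod_stable w xM Mn').
rewrite finite_jacobi_triple // mulr_sumr big_map.
rewrite -[iota 0 _]/(index_iota 0 (n + n).+1) big_mkord; apply: eq_bigr => k _.
have [kM|kM] := leqP (M + 2) `|k%:Z - n%:Z|.
  by rewrite (theta_term0 _ _ xM kM) mul0r mulr0.
case: k kM => k /= kn kM; rewrite mulrCA.
have [b Eb] : exists b, (n + n = k + b)%N by exists (n + n - k)%N; lia.
by rewrite Eb qbin_stable ?mulr1 //; lia.
Qed.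

(** * Products over odd and even parts, and their theta series *)

Lemma double_bin2 a : ('C(a, 2) * 2 = a * a.-1)%N.
Proof. by elim: a => // a IH; rewrite binS bin1; nia. Qed.

Lemma theta_term_phi (R : comNzRingType) (q : R) j :
  theta_term q q (q ^+ 2) j = q ^+ (`|j| ^ 2).
Proof.
have H a : q ^+ a * (q ^+ 2) ^+ 'C(a, 2) = q ^+ (a ^ 2).
  rewrite -exprM -exprD; congr (_ ^+ _).
  by rewrite [(2 * _)%N]mulnC double_bin2; case: a => // a; nia.
by case: j => a; apply: H.
Qed.

Lemma theta_term_psi (R : comNzRingType) (q : R) j :
  theta_term 1 (q ^+ 2) (q ^+ 2) j = q ^+ `|j * (j - 1)|.
Proof.
case: j => a; rewrite /theta_term ?expr1n ?mul1r -!exprM -?exprD; congr (_ ^+ _).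
  by rewrite mulnC double_bin2; case: a => // a; rewrite abszM; nia.
by rewrite NegzE abszM [(2 * 'C(_, _))%N]mulnC double_bin2; nia.
Qed.

(** The first factor of [qprod 1 x] is 2; the others form [qprod x x], one factor
shorter, which nilpotency makes irrelevant. *)
Lemma qprod1 (R : comNzRingType) (x : R) M :
  x ^+ M = 0 -> qprod 1 x M = qprod x x M *+ 2.
Proof.
move=> xM; rewrite -(qprod_stable (n := M.+1) _ xM) //.
by rewrite qprodSl mulrDl !mul1r mulr2n.
Qed.

Definition odd_prod (R : comNzRingType) (q : R) M := qprod q (q ^+ 2) M.

Definition even_prod (R : comNzRingType) (q : R) M := qprod (q ^+ 2) (q ^+ 2) M.

Definition euler_prod (R : comNzRingType) (q : R) M := qprod (- q ^+ 2) (q ^+ 2) M.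

(** Euler: prod (1 + q^i) * prod (1 - q^i) = prod (1 - q^(2i)); splitting the
indices of both left-hand products by parity, the even part of the second one
cancels against the right-hand side. *)
Lemma euler_odd_distinct (R : comNzRingType) (q : R) M : q ^+ M = 0 ->
  odd_prod q M * even_prod q M * odd_prod (- q) M = 1.
Proof.
move=> qM; have q2M := expr_expr_nil qM (ltn0Sn 1).
apply: (qprod_lreg (n := M) q2M); rewrite mulr1 /odd_prod sqrrN /even_prod.
have := qprod_sqr q q M.*2.
rewrite (qprod_double q) (qprod_double (- q)) mulNr -expr2.
rewrite (qprod_stable _ q2M (_ : M <= M.*2)%N); last lia.
move=> E; rewrite -[RHS]E; ring.
Qed.

(** The triple product at y = w = q and base q^2. *)
Lemma jacobi_phi (R : comNzRingType) (q : R) M n :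
  q ^+ M = 0 -> (M.*2 + 2 <= n)%N ->
  euler_prod q M * odd_prod q M ^+ 2 = \sum_(j <- irange n) q ^+ (`|j| ^ 2).
Proof.
move=> qM Mn; have q2M := expr_expr_nil qM (ltn0Sn 1).
rewrite expr2 (jacobi_triple q2M _ Mn) //.
by apply: eq_bigr => j _; apply: theta_term_phi.
Qed.

(** The triple product at y = 1, w = q^2 and base q^2; the factor 2 is the value of
1 + y. *)
Lemma jacobi_psi (R : comNzRingType) (q : R) M n :
  q ^+ M = 0 -> (M.*2 + 2 <= n)%N ->
  euler_prod q M * even_prod q M ^+ 2 *+ 2 =
  \sum_(j <- irange n) q ^+ `|(j * (j - 1))%R|.
Proof.
move=> qM Mn; have q2M := expr_expr_nil qM (ltn0Sn 1).
rewrite -mulrnAr expr2 -mulrnAl -(qprod1 q2M) (jacobi_triple q2M (mul1r _) Mn).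
by apply: eq_bigr => j _; apply: theta_term_psi.
Qed.

(** * The correspondence between the two lattice sums *)

(** The bijections h and g need not preserve the finite window B: it is enough that
B contains all the points of exponent less than M, as the other terms vanish. *)
Lemma sum_lattice_reindex (R : comNzRingType) (q : R) M (B : seq (int * int))
    (E1 E2 : int * int -> nat) (P1 P2 : pred (int * int))
    (h g : int * int -> int * int) :
  q ^+ M = 0 -> uniq B ->
  (forall z, (E1 z < M)%N -> z \in B) -> (forall z, (E2 z < M)%N -> z \in B) ->
  (forall z, P1 z -> [/\ P2 (h z), E2 (h z) = E1 z & g (h z) = z]) ->
  (forall z, P2 z -> P1 (g z) /\ h (g z) = z) ->
  \sum_(z <- B | P1 z) q ^+ E1 z = \sum_(z <- B | P2 z) q ^+ E2 z.
Proof.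
move=> qM uB B1 B2 hP gP.
have trunc (E : int * int -> nat) (P : pred (int * int)) :
    \sum_(z <- B | P z) q ^+ E z =
    \sum_(z <- [seq z <- B | P z && (E z < M)%N]) q ^+ E z.
  rewrite big_filter big_mkcondr; apply: eq_bigr => z _.
  by case: leqP => // /(expr_nil qM).
rewrite !trunc (eq_big_seq (fun z => q ^+ E2 (h z))); last first.
  by move=> z; rewrite mem_filter => /andP[/andP[/hP[_ -> _]]].
rewrite -(big_map h xpredT (fun z => q ^+ E2 z)); apply/perm_big/uniq_perm.
- rewrite map_inj_in_uniq ?filter_uniq // => z t; rewrite !mem_filter.
  move=> /andP[/andP[/hP[_ _ zK] _] _] /andP[/andP[/hP[_ _ tK] _] _].
  by move=> /(congr1 g); rewrite zK tK.
- exact: filter_uniq.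
move=> t; rewrite mem_filter; apply/mapP/andP => [[z]|].
  rewrite mem_filter => /andP[/andP[/hP[P2z E2z _] zM] _ ->].
  by rewrite P2z E2z zM; split=> //; apply: B2; rewrite E2z.
move=> [/andP[/gP[P1t tK] tM] _]; exists (g t) => //.
have [_ E _] := hP _ P1t; rewrite mem_filter P1t -E tK tM /=.
by apply: B1; rewrite -E tK.
Qed.

Definition phi_exp (z : int * int) : nat := (`|z.1| ^ 2 + 3 * `|z.2| ^ 2)%N.

(** With u = 2 z.1 - 1 and v = 2 z.2 - 1 this is (u^2 + 3 v^2) / 4. *)
Definition psi_exp (z : int * int) : nat :=
  (`|(z.1 * (z.1 - 1))%R| + 3 * `|(z.2 * (z.2 - 1))%R|).+1.

Lemma phi_expE z : (phi_exp z)%:Z = z.1 ^+ 2 + 3 * z.2 ^+ 2.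
Proof. by rewrite /phi_exp; nia. Qed.

Lemma psi_expE z : (psi_exp z)%:Z = z.1 * (z.1 - 1) + 3 * (z.2 * (z.2 - 1)) + 1.
Proof.
have pos (j : int) : 0 <= j * (j - 1) by nia.
by have := pos z.1; have := pos z.2; rewrite /psi_exp; lia.
Qed.

(** Points with a small [psi_exp] have small coordinates. *)
Lemma leq_abs_pronic (j : int) : (`|j| <= `|(j * (j - 1))%R| + 1)%N.
Proof. nia. Qed.

(** On the left the terms with j + k even cancel and the others double.  On the
right the pairs of equal parity and those of different parity contribute one copy
each. *)
Lemma theta_lattice_identity (R : comNzRingType) (q : R) M n :
  q ^+ M = 0 -> (M <= n)%N ->
  \sum_(j <- irange n) \sum_(k <- irange n)
     (q ^+ phi_exp (j, k) - (- q) ^+ phi_exp (j, k)) =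
  \sum_(j <- irange n) \sum_(k <- irange n) q ^+ psi_exp (j, k).
Proof.
move=> qM Mn; set B := [seq (j, k) | j <- irange n, k <- irange n].
have Bn z : (`|z.1| <= n)%N -> (`|z.2| <= n)%N -> z \in B.
  by case: z => j k /= jn kn; apply: allpairs_f; rewrite mem_irange.
have B1 z : (phi_exp z < M)%N -> z \in B.
  by rewrite /phi_exp => zM; apply: Bn; nia.
have B2 z : (psi_exp z < M)%N -> z \in B.
  rewrite /psi_exp => zM; have := leq_abs_pronic z.1.
  by have := leq_abs_pronic z.2 => *; apply: Bn; lia.
have uB : uniq B by apply: allpairs_uniq => [||[a b] [c d]]; rewrite ?irange_uniq.
pose par (z : int * int) := odd `|(z.1 + z.2)%R|.
rewrite -(big_allpairs (F := fun z => q ^+ phi_exp z - (- q) ^+ phi_exp z)).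
rewrite -(big_allpairs (F := fun z => q ^+ psi_exp z)) -/B.
transitivity (\sum_(z <- B | par z) q ^+ phi_exp z *+ 2).
  rewrite [RHS]big_mkcond; apply: eq_bigr => z _.
  rewrite exprNn -signr_odd; have -> : odd (phi_exp z) = par z.
    by rewrite /par /phi_exp oddD oddM !oddX /=; lia.
  by case: (par z); rewrite ?expr1 ?mulN1r ?opprK ?expr0 ?mul1r ?subrr // mulr2n.
rewrite sumrMnl mulr2n [RHS](bigID par) [RHS]addrC /=; congr (_ + _).
- (* Equal parity: (j, k) = (k + 2 d, k) corresponds to (2 k - 1 + d, d). *)
  apply: (sum_lattice_reindex qM uB B1 B2
    (h := fun z => let k := ((z.1 - z.2 + 1) %/ 2)%Z in (k + 2 * z.2, k))
    (g := fun z => let d := ((z.1 - z.2) %/ 2)%Z in (2 * z.2 - 1 + d, d))).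
  + move=> [m d]; rewrite /par /= => pz.
    have [k ->] : exists k, m = 2 * k - 1 + d by exists ((m - d + 1) %/ 2)%Z; lia.
    have -> : ((2 * k - 1 + d - d + 1) %/ 2)%Z = k by lia.
    have -> : ((k + 2 * d - k) %/ 2)%Z = d by lia.
    split; [lia| |by []].
    by apply: (can_inj absz_nat); rewrite psi_expE phi_expE /=; ring.
  + move=> [j k]; rewrite /par /= => pz.
    have [d ->] : exists d, j = k + 2 * d by exists ((j - k) %/ 2)%Z; lia.
    have -> : ((k + 2 * d - k) %/ 2)%Z = d by lia.
    have -> : ((2 * k - 1 + d - d + 1) %/ 2)%Z = k by lia.
    by split; [lia|].
- (* Different parity: the same correspondence with 1 - k in place of k. *)
  apply: (sum_lattice_reindex qM uB B1 B2
    (h := fun z => let k := ((z.1 - z.2 + 1) %/ 2)%Z in (k + 2 * z.2, 1 - k))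
    (g := fun z => let d := ((z.1 + z.2 - 1) %/ 2)%Z in (1 - 2 * z.2 + d, d))).
  + move=> [m d]; rewrite /par /= => pz.
    have [k ->] : exists k, m = 2 * k - 1 + d by exists ((m - d + 1) %/ 2)%Z; lia.
    have -> : ((2 * k - 1 + d - d + 1) %/ 2)%Z = k by lia.
    have -> : ((k + 2 * d + (1 - k) - 1) %/ 2)%Z = d by lia.
    split; [lia| |by congr (_, _); lia].
    by apply: (can_inj absz_nat); rewrite psi_expE phi_expE /=; ring.
  + move=> [j k]; rewrite /par /= => pz.
    have [d ->] : exists d, j = 1 - k + 2 * d by exists ((j + k - 1) %/ 2)%Z; lia.
    have -> : ((1 - k + 2 * d + k - 1) %/ 2)%Z = d by lia.
    have -> : ((1 - 2 * k + d - d + 1) %/ 2)%Z = 1 - k by lia.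
    by split; [lia|congr (_, _); lia].
Qed.

(** * The product identities *)

(** Ramanujan's phi(q) phi(q^3) - phi(-q) phi(-q^3) = 4 q psi(q^2) psi(q^6), with
the common Euler products removed. *)
Lemma phi_psi_identity (R : comNzRingType) (q : R) M : q ^+ M = 0 ->
  odd_prod q M ^+ 2 * odd_prod (q ^+ 3) M ^+ 2
    - odd_prod (- q) M ^+ 2 * odd_prod (- q ^+ 3) M ^+ 2 =
  4 * q * even_prod q M ^+ 2 * even_prod (q ^+ 3) M ^+ 2.
Proof.
move=> qM; pose n := (M.*2 + 2)%N.
have q2M := expr_expr_nil qM (ltn0Sn 1); have q3M := expr_expr_nil qM (ltn0Sn 2).
have q6M := expr_expr_nil q3M (ltn0Sn 1).
(* Restore the Euler products that turn the squares into theta series. *)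
apply: (qprod_lreg (n := M) q2M); apply: (qprod_lreg (n := M) q6M).
rewrite -/(euler_prod q M) -/(euler_prod (q ^+ 3) M).
have phi2 (x : R) : x ^+ M = 0 ->
    euler_prod x M * odd_prod x M ^+ 2 *
      (euler_prod (x ^+ 3) M * odd_prod (x ^+ 3) M ^+ 2) =
    \sum_(j <- irange n) \sum_(k <- irange n) x ^+ phi_exp (j, k).
  move=> xM; rewrite !(jacobi_phi (n := n)) ?expr_expr_nil // big_distrlr /=.
  by do 2 (apply: eq_bigr => ? _); rewrite -exprM -exprD.
have psi2 : q * (euler_prod q M * even_prod q M ^+ 2 *+ 2 *
      (euler_prod (q ^+ 3) M * even_prod (q ^+ 3) M ^+ 2 *+ 2)) =
    \sum_(j <- irange n) \sum_(k <- irange n) q ^+ psi_exp (j, k).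
  rewrite !(jacobi_psi (n := n)) // big_distrlr mulr_sumr /=.
  apply: eq_bigr => j _; rewrite mulr_sumr; apply: eq_bigr => k _.
  by rewrite -exprM -exprD -exprS.
have NqM : (- q) ^+ M = 0 by rewrite exprNn qM mulr0.
have phi2N := phi2 _ NqM; have {}phi2 := phi2 _ qM.
have N3 : (- q) ^+ 3 = - q ^+ 3 by ring.
rewrite N3 /euler_prod !sqrrN -!/(euler_prod _ M) in phi2N.
transitivity (q * (euler_prod q M * even_prod q M ^+ 2 *+ 2 *
  (euler_prod (q ^+ 3) M * even_prod (q ^+ 3) M ^+ 2 *+ 2))); last by ring.
rewrite psi2 -(theta_lattice_identity qM (_ : M <= n)%N); last by rewrite /n; lia.
under [RHS]eq_bigr do rewrite sumrB.
rewrite sumrB -phi2 -phi2N /euler_prod; ring.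
Qed.

(** Multiply [phi_psi_identity] by a(q)^2 a(q^3)^2 b(q)^2 b(q^3)^2; by Euler's
theorem the second term on the left becomes 1. *)
Lemma ST_product_identity (R : comNzRingType) (q : R) M : q ^+ M = 0 ->
  odd_prod q M ^+ 4 * odd_prod (q ^+ 3) M ^+ 4 *
    even_prod q M ^+ 2 * even_prod (q ^+ 3) M ^+ 2 =
  1 + 4 * q * (odd_prod q M ^+ 2 * odd_prod (q ^+ 3) M ^+ 2 *
    even_prod q M ^+ 4 * even_prod (q ^+ 3) M ^+ 4).
Proof.
move=> qM; have := phi_psi_identity qM; have := euler_odd_distinct qM.
have := euler_odd_distinct (expr_expr_nil qM (ltn0Sn 2)).
move: (odd_prod q M) (odd_prod (- q) M) (odd_prod (q ^+ 3) M)
  (odd_prod (- q ^+ 3) M) (even_prod q M) (even_prod (q ^+ 3) M).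
move=> a a' c c' B E cE aB phi_psi.
transitivity ((a * B * a') ^+ 2 * (c * E * c') ^+ 2 +
   a ^+ 2 * c ^+ 2 * B ^+ 2 * E ^+ 2 * (a ^+ 2 * c ^+ 2 - a' ^+ 2 * c' ^+ 2)).
  ring.
rewrite phi_psi aB cE; ring.
Qed.

(** * Sorting the parts by residue modulo 6 *)

(** The generating function of the partitions into distinct elements, with m v
copies of the value v, and values at most n. *)
Definition gen_prod (R : comNzRingType) (m : nat -> nat) (q : R) (n : nat) : R :=
  \prod_(v < n) (1 + q ^+ v.+1) ^+ m v.+1.

Lemma prod_block (R : comNzRingType) (f : nat -> R) n k :
  \prod_(i < n * k) f i = \prod_(i < n) \prod_(r < k) f (i * k + r)%N.
Proof.
elim: n => [|n IH]; first by rewrite !big_ord0.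
by rewrite mulSn addnC big_split_ord big_ord_recr IH.
Qed.

Lemma odd_prod6 (R : comNzRingType) (q : R) M : q ^+ M = 0 ->
  odd_prod q M = \prod_(i < M)
    ((1 + q ^+ (i * 6 + 1)) * (1 + q ^+ (i * 6 + 3)) * (1 + q ^+ (i * 6 + 5))).
Proof.
move=> qM; have q2M := expr_expr_nil qM (ltn0Sn 1).
(* Each period of length 6 contains three odd indices. *)
rewrite /odd_prod -(qprod_stable (n := M * 3) _ q2M) ?leq_pmulr //.
rewrite /qprod (prod_block (fun i => 1 + q * (q ^+ 2) ^+ i)).
apply: eq_bigr => i _.
rewrite !big_ord_recl big_ord0 mulr1 /= -!exprM -!exprS !mulrA.
by congr ((1 + q ^+ _) * (1 + q ^+ _) * (1 + q ^+ _)); rewrite ?/bump /=; lia.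
Qed.

Lemma even_prod6 (R : comNzRingType) (q : R) M : q ^+ M = 0 ->
  even_prod q M = \prod_(i < M)
    ((1 + q ^+ (i * 6 + 2)) * (1 + q ^+ (i * 6 + 4)) * (1 + q ^+ (i * 6 + 6))).
Proof.
move=> qM; have q2M := expr_expr_nil qM (ltn0Sn 1).
rewrite /even_prod -(qprod_stable (n := M * 3) _ q2M) ?leq_pmulr //.
rewrite /qprod (prod_block (fun i => 1 + q ^+ 2 * (q ^+ 2) ^+ i)).
apply: eq_bigr => i _.
rewrite !big_ord_recl big_ord0 mulr1 /= -!exprS -!exprM !mulrA.
by congr ((1 + q ^+ _) * (1 + q ^+ _) * (1 + q ^+ _)); rewrite ?/bump /=; lia.
Qed.

Lemma odd_prod_cube (R : comNzRingType) (q : R) M :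
  odd_prod (q ^+ 3) M = \prod_(i < M) (1 + q ^+ (i * 6 + 3)).
Proof.
apply: eq_bigr => i _; rewrite -!exprM -exprD.
by congr (1 + q ^+ _); lia.
Qed.

Lemma even_prod_cube (R : comNzRingType) (q : R) M :
  even_prod (q ^+ 3) M = \prod_(i < M) (1 + q ^+ (i * 6 + 6)).
Proof.
apply: eq_bigr => i _; rewrite -!exprM -exprD.
by congr (1 + q ^+ _); lia.
Qed.

Lemma multS_periodic i r : multS (i * 6 + r) = multS r.
Proof.
have odd6 : odd (i * 6 + r) = odd r by lia.
have dvd3 : (3 %| i * 6 + r)%N = (3 %| r)%N by lia.
by rewrite /multS modnMDl odd6 dvd3.
Qed.

Lemma multT_periodic i r : multT (i * 6 + r) = multT r.
Proof. by rewrite /multT /dvdn modnMDl. Qed.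

Lemma gen_prod6 (R : comNzRingType) m (q : R) n :
  gen_prod m q (n * 6) = \prod_(i < n)
    ((1 + q ^+ (i * 6 + 1)) ^+ m (i * 6 + 1)%N *
     (1 + q ^+ (i * 6 + 2)) ^+ m (i * 6 + 2)%N *
     (1 + q ^+ (i * 6 + 3)) ^+ m (i * 6 + 3)%N *
     (1 + q ^+ (i * 6 + 4)) ^+ m (i * 6 + 4)%N *
     (1 + q ^+ (i * 6 + 5)) ^+ m (i * 6 + 5)%N *
     (1 + q ^+ (i * 6 + 6)) ^+ m (i * 6 + 6)%N).
Proof.
rewrite /gen_prod (prod_block (fun v => (1 + q ^+ v.+1) ^+ m v.+1)).
apply: eq_bigr => i _; rewrite !big_ord_recl big_ord0 mulr1 /= /bump /= -!addnS.
by rewrite !mulrA.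
Qed.

Lemma gen_prod_stable (R : comNzRingType) m (q : R) M n : q ^+ M = 0 ->
  (M.-1 <= n)%N -> gen_prod m q n = gen_prod m q M.-1.
Proof.
move=> qM; apply: (@prod_stable _ (fun v => (1 + q ^+ v.+1) ^+ m v.+1)) => i Mi.
by rewrite (expr_nil qM) ?addr0 ?expr1n //; lia.
Qed.

Lemma gen_prodS (R : comNzRingType) (q : R) M : q ^+ M = 0 ->
  gen_prod multS q (M * 6) = odd_prod q M ^+ 4 * odd_prod (q ^+ 3) M ^+ 4 *
    even_prod q M ^+ 2 * even_prod (q ^+ 3) M ^+ 2.
Proof.
move=> qM; rewrite gen_prod6 odd_prod6 // even_prod6 // odd_prod_cube even_prod_cube.
rewrite -!prodrXl -!big_split; apply: eq_bigr => i _ /=.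
rewrite !multS_periodic /=; ring.
Qed.

Lemma gen_prodT (R : comNzRingType) (q : R) M : q ^+ M = 0 ->
  gen_prod multT q (M * 6) = odd_prod q M ^+ 2 * odd_prod (q ^+ 3) M ^+ 2 *
    even_prod q M ^+ 4 * even_prod (q ^+ 3) M ^+ 4.
Proof.
move=> qM; rewrite gen_prod6 odd_prod6 // even_prod6 // odd_prod_cube even_prod_cube.
rewrite -!prodrXl -!big_split; apply: eq_bigr => i _ /=.
rewrite !multT_periodic /=; ring.
Qed.

(** The product identity holds at a multiple of 6, where the factors can be grouped
by residue; nilpotency transfers it to any length. *)
Lemma gen_prod_identity (R : comNzRingType) (q : R) M n :
  q ^+ M = 0 -> (M.-1 <= n)%N ->
  gen_prod multS q n = 1 + 4 * q * gen_prod multT q n.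
Proof.
move=> qM Mn; have M6 : (M.-1 <= M * 6)%N by lia.
rewrite !(gen_prod_stable _ qM Mn) -!(gen_prod_stable _ qM M6).
by rewrite gen_prodS // gen_prodT // ST_product_identity.
Qed.

(** * Partitions as coefficients *)

(** Expanding the product: each element is either chosen or not. *)
Lemma prod_1D_fset (R : comNzRingType) (T : choiceType) (E : {fset T}) (F : T -> R) :
  \prod_(x <- E) (1 + F x) = \sum_(A <- fpowerset E) \prod_(x <- A) F x.
Proof.
rewrite big_seq_fsetE /=; under eq_bigr do rewrite addrC.
rewrite bigA_distr big_imfset /=; last first.
  by move=> X Y _ _ /fsetP eqXY; apply/setP => x; have := eqXY (val x); rewrite !inE.
rewrite [RHS]big_enum /=; apply: eq_big => [J|J _].
  by rewrite powersetE subsetT.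
rewrite [RHS]big_imfset /=; last by move=> x y _ _; apply: val_inj.
by rewrite big_enum /= -big_mkcond.
Qed.

Lemma D_coef (m : nat -> nat) (N : nat) :
  (D m N)%:R = (gen_prod m 'X N : {poly int})`_N.
Proof.
have -> : gen_prod m 'X N =
    \prod_(x <- elements_upto m N) (1 + 'X^(value x)) :> {poly int}.
  rewrite (perm_big [seq (v, c) | v <- iota 1 N, c <- iota 0 (m v)]) /=; last first.
    apply: uniq_perm; first exact: fset_uniq.
      apply: allpairs_uniq_dep => [||[a b] [c d] _ _ [-> ->]] //.
        exact: iota_uniq.
      by move=> *; apply: iota_uniq.
    by move=> x; rewrite /elements_upto inE.
  rewrite big_allpairs_dep /value /=.
  rewrite /gen_prod -(big_mkord xpredT (fun v => (1 + 'X^(v.+1)) ^+ m v.+1)).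
  rewrite (iotaDl 1 0 N) big_map /index_iota subn0; apply: eq_bigr => v _.
  by rewrite big_const_seq count_predT size_iota iter_mulr mulr1.
rewrite prod_1D_fset coef_sum /D card_fset_sum1 natr_sum.
rewrite /partitions big_fset /= big_mkcond.
rewrite big_seq [RHS]big_seq; apply: eq_bigr => A.
rewrite fpowersetE => /fsubsetP sub.
rewrite prodrXr coefXn /is_partition eq_sym.
have -> : all (copies m) A.
  by apply/allP => x /sub; rewrite elements_uptoP => /andP[].
by case: eqP.
Qed.

Lemma gen_prod_map (R S : comNzRingType) (f : {rmorphism R -> S}) m (q : R) n :
  f (gen_prod m q n) = gen_prod m (f q) n.
Proof.
rewrite rmorph_prod; apply: eq_bigr => i _.
by rewrite rmorphXn rmorphD rmorph1 rmorphXn.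
Qed.

Lemma mk_monicXn (M : nat) : (0 < M)%N -> mk_monic 'X^M = 'X^M :> {poly int}.
Proof. by move=> M0; rewrite /mk_monic size_polyXn monicXn ltnS M0. Qed.

Lemma in_qpolyX_coef (M : nat) (p r : {poly int}) : (0 < M)%N ->
  in_qpoly 'X^M p = in_qpoly 'X^M r -> forall i, (i < M)%N -> p`_i = r`_i.
Proof.
move=> M0 /(congr1 val) /= + i iM.
rewrite mk_monicXn //; have mX := monicXn int M.
rewrite {2}(Pdiv.RingMonic.rdivp_eq mX p) {2}(Pdiv.RingMonic.rdivp_eq mX r).
by move=> E; rewrite !coefD !coefMXn iM E.
Qed.

Lemma in_qpolyX_nil M : (0 < M)%N -> (in_qpoly ('X^M : {poly int}) 'X) ^+ M = 0.
Proof.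
move=> M0; rewrite -rmorphXn; apply: val_inj => /=.
rewrite mk_monicXn //; exact: Pdiv.RingMonic.rmodpp (monicXn _ _).
Qed.

(** The factors with v > N equal 1 modulo X^(N+1), so that the length of the
product may exceed N.  This lets D_S(N+1) and D_T(N) be read from products of the
same length. *)
Lemma D_coef_ge m N n : (N <= n)%N -> (D m N)%:R = (gen_prod m 'X n : {poly int})`_N.
Proof.
move=> Nn; rewrite D_coef; apply: (@in_qpolyX_coef N.+1) => //.
have qM := @in_qpolyX_nil N.+1 isT.
by rewrite !gen_prod_map (gen_prod_stable m qM Nn).
Qed.

Lemma D_recurrence N : (D_S N.+1)%:R = 4 * (D_T N)%:R :> int.
Proof.
rewrite /D_S /D_T (@D_coef_ge _ N.+1 N.+1) // (@D_coef_ge _ N N.+1) //.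
rewrite -[RHS](_ : (1 + 4 * 'X * gen_prod multT 'X N.+1 : {poly int})`_N.+1 = _).
  apply: (@in_qpolyX_coef N.+2) => //.
  have qM := @in_qpolyX_nil N.+2 isT.
  rewrite rmorphD rmorph1 !rmorphM rmorph_nat !gen_prod_map.
  exact: gen_prod_identity qM _.
by rewrite -mulrA coefD coef1 add0r mulr_natl coefMn coefXM mulr_natl.
Qed.

Local Close Scope ring_scope.

Theorem theorem3p17 (N : nat) (hN : 1 <= N) : D_S N = 4 * D_T (N - 1).
Proof.
case: N hN => // N _; rewrite subSS subn0.
by have /eqP := D_recurrence N; rewrite -natrM Num.Theory.eqr_nat => /eqP.
Qed.
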